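(* There is a semi-Vatican square on the index set $\mathbb{R}\subseteq\mathbb{R}$ that is based on the group $(\mathbb{R},+)$, i.e. a square of the form $L(i,j)=\mathbf a(j)-\mathbf a(i)$ for some bijection $\mathbf a:\mathbb{R}\to\mathbb{R}$.
   Context: For the index set $I=\mathbb{R}$ in the ordered field $\mathbb{R}$ (so $I_{(d)}=\mathbb{R}$ for every $d>0$), a Latin square $L:\mathbb{R}\times\mathbb{R}\to X$ (each row map $j\mapsto L(i,j)$ and column map $j\mapsto L(j,i)$ a bijection onto $X$) is semi-Vatican if for every $d>0$ and every unordered pair $\{x,y\}$ of distinct symbols there is exactly one $(i,j)$ with $\{L(i,j),L(i,j+d)\}=\{x,y\}$ and exactly one $(i,j)$ with $\{L(i,j),L(i+d,j)\}=\{x,y\}$. *)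

(* Defs.v *)
From HB Require Import structures.
From mathcomp Require Import all_boot all_order all_algebra.
From mathcomp Require Import all_classical all_reals.

Set Implicit Arguments.
Unset Strict Implicit.
Unset Printing Implicit Defensive.

Import Order.TTheory GRing.Theory Num.Theory.
Local Open Scope ring_scope.
Local Open Scope classical_set_scope.

Definition latin_square (R : realType) (X : Type) (L : R -> R -> X) : Prop :=
  (forall i, bijective (fun j => L i j)) /\ (forall i, bijective (fun j => L j i)).

(* The index set is the whole field, so i + d and j + d are always indices.
   The unordered pair {x, y} is the classical set [set x; y]. *)
Definition semi_vatican (R : realType) (X : Type) (L : R -> R -> X) : Prop :=
  latin_square L /\
  forall (d : R) (x y : X), 0 < d -> x <> y ->
    (exists! p : R * R, [set L p.1 p.2; L p.1 (p.2 + d)] = [set x; y]) /\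
    (exists! p : R * R, [set L p.1 p.2; L (p.1 + d) p.2] = [set x; y]).

Definition based_on_additive_group (R : realType) (L : R -> R -> R) : Prop :=
  exists2 a : R -> R, bijective a & forall i j, L i j = a j - a i.

(* Main.v *)
Require Import Defs.
From mathcomp Require Import all_boot all_order all_algebra.
From mathcomp Require Import all_classical all_reals.
From mathcomp Require Import ring lra.

(** If [a] is increasing, the square [a j - a i] is semi-Vatican as soon as
    every increment map [j |-> a (j + d) - a j] with [d > 0] is a bijection onto
    the positive numbers.  Strict convexity makes increments injective; they are
    onto when the slope of [a] runs from [0] to infinity.  Such an [a] that is
    moreover onto is the function whose graph consists of the half parabolas
    [y = x + x^2] for [x >= 0] and [x = y - y^2] for [y <= 0]. *)

Import Order.TTheory GRing.Theory Num.Theory.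
Local Open Scope ring_scope.
Local Open Scope classical_set_scope.

Lemma set2_lt_inj (R : realDomainType) (u v x y : R) :
  u < v -> x < y -> [set u; v] = [set x; y] -> u = x /\ v = y.
Proof.
move=> uv xy E.
have : [set x; y] u by rewrite -E; left.
have : [set x; y] v by rewrite -E; right.
have : [set u; v] x by rewrite E; left.
have : [set u; v] y by rewrite E; right.
by move=> /= [] ? [] ? [] ? [] ?; split; lra.
Qed.

(** Two entries of a row at distance [d] differ by an increment of [a] that does not depend on the
    row. So [y - x] fixes the column, and the value [x] then fixes the row. *)
Lemma semi_vatican_increments (R : realType) (a : R -> R) :
  bijective a -> {homo a : x y / x < y} ->
  (forall d e, 0 < d -> 0 < e -> exists! j, a (j + d) - a j = e) ->
  semi_vatican (fun i j => a j - a i).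
Proof.
move=> bij_a a_incr incr; have a_inj := bij_inj bij_a.
have [b bK aK] := bij_a.
split.
  split=> i.
    exists (fun t => b (t + a i)) => t; first by rewrite subrK bK.
    by rewrite aK addrK.
  exists (fun t => b (a i - t)) => t; first by rewrite subKr bK.
  by rewrite aK subKr.
move=> d x y d_gt0.
have lt_ad j : a j < a (j + d) by apply: a_incr; rewrite ltrDl.
wlog xy : x y / x < y.
  move=> H neq; have [/H/(_ neq)//|yx|/neq//] := ltgtP x y.
  by rewrite (setUC [set x]); apply: H => // /esym.
move=> _; have [j [jE j_uniq]] := incr d (y - x) d_gt0 ltac:(lra).
split.
- exists (b (a j - x), j); split=> /=.
    by rewrite aK; congr [set _; _]; lra.
  move=> [i k] /= /set2_lt_inj [|//|E1 E2]; first by have := lt_ad k; lra.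
  have -> : j = k by apply: j_uniq; lra.
  by rewrite -(bK i); congr (b _, _); lra.
- exists (j, b (a j + y)); split=> /=.
    by rewrite aK setUC; congr [set _; _]; lra.
  move=> [i k] /=; rewrite setUC => /set2_lt_inj [|//|E1 E2].
    by have := lt_ad i; lra.
  have ji : j = i by apply: j_uniq; lra.
  by rewrite -(bK k) -ji in E2 *; congr (_, b _); move: E2; rewrite !bK; lra.
Qed.

(** The points [(cx u, cy u)] run through the graph of [a]. *)
Definition cx {R : realType} (u : R) : R := if u < 0 then u - u ^+ 2 else u.
Definition cy {R : realType} (u : R) : R := if u < 0 then u else u + u ^+ 2.

Lemma cx_bij (R : realType) : bijective (@cx R).
Proof.
exists (fun x : R => if x < 0 then (1 - Num.sqrt (1 - 4 * x)) / 2 else x) => x;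
  rewrite /cx; case: (ltP x 0) => x0; rewrite ?(ltNge x) ?x0 //.
  have -> : x - x ^+ 2 < 0 by nra.
  have -> : 1 - 4 * (x - x ^+ 2) = (1 - 2 * x) ^+ 2 by ring.
  by rewrite sqrtr_sqr ger0_norm; lra.
have := @sqr_sqrtr _ (1 - 4 * x) ltac:(lra).
move: (Num.sqrt _) (sqrtr_ge0 (1 - 4 * x)) => s s0 sE.
have -> : (1 - s) / 2 < 0 by nra.
by field: sE.
Qed.

(** The curve is symmetric about the line [x + y = 0], so bijectivity passes from [cx] to [cy]. *)
Lemma cyE (R : realType) : @cy R =1 (fun u => - cx (- u)).
Proof.
by move=> u; rewrite /cx /cy; case: ltP => ?; case: ltP => ?; nra.
Qed.

Lemma cy_bij (R : realType) : bijective (@cy R).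
Proof.
have oppr_bij : bijective (@GRing.opp R) := inv_bij (@opprK R).
apply: (eq_bij (f := -%R \o (@cx R \o -%R))) => [|u]; last by rewrite cyE.
exact: bij_comp oppr_bij (bij_comp (@cx_bij R) oppr_bij).
Qed.

(** Here [s] is the slope of the curve at [u]. Up to a positive factor, the gap is [(v - u)^2] when
    [v] is on the branch of [u], and [(v - u)^2 + 2 |u| v^2] otherwise. *)
Lemma curve_above_tangent (R : realType) (u : R) :
  exists2 s, 0 < s & forall v, v != u -> s * (cx v - cx u) < cy v - cy u.
Proof.
rewrite /cx /cy; case: (ltP u 0) => u0.
  exists (1 - 2 * u)^-1 => [|v vu]; first by rewrite invr_gt0; lra.
  rewrite mulrC ltr_pdivrMr; last by lra.
  have : 0 < (v - u) ^+ 2 by rewrite exprn_even_gt0 //= subr_eq0.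
  case: (ltP v 0) => v0; first by nra.
  have : 0 <= - u * v ^+ 2 by rewrite mulr_ge0 ?sqr_ge0; lra.
  by nra.
exists (1 + 2 * u) => [|v vu]; first by lra.
have : 0 < (v - u) ^+ 2 by rewrite exprn_even_gt0 //= subr_eq0.
case: (ltP v 0) => v0; last by nra.
have : 0 <= u * v ^+ 2 by rewrite mulr_ge0 ?sqr_ge0.
by nra.
Qed.

Lemma curve_chord (R : realType) (d e : R) : 0 < d -> 0 < e ->
  exists u v, cx v - cx u = d /\ cy v - cy u = e.
Proof.
move=> d0 e0; rewrite /cx /cy.
(* A steep chord has both ends on the upper parabola, a flat one both on the lower; either way the
   equation for [u] is linear. *)
have [le1|lt1] := leP (d + d ^+ 2) e.
  pose u := (e - d - d ^+ 2) / (2 * d).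
  have uE : u * (2 * d) = e - d - d ^+ 2 by rewrite divfK //; lra.
  have u0 : 0 <= u by nra.
  by exists u, (u + d); rewrite !ltNge u0 (addr_ge0 u0 (ltW d0)) /=; split; nra.
have [le2|lt2] := ltP (e + e ^+ 2) d.
  pose u := (e - e ^+ 2 - d) / (2 * e).
  have uE : u * (2 * e) = e - e ^+ 2 - d by rewrite divfK //; lra.
  have v0 : u + e < 0 by nra.
  have u0 : u < 0 by lra.
  by exists u, (u + e); rewrite u0 v0; split; nra.
(* The chord from the lower to the upper parabola: a root of a quartic in [u]. *)
pose p : {poly R} := let q := 'X - 'X^2 + d%:P in q ^+ 2 + q - 'X - e%:P.
have pE u : p.[u] = (u - u ^+ 2 + d) ^+ 2 + (u - u ^+ 2 + d) - u - e.
  by rewrite /p !(hornerE, hornerXn).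
(* With [v = cx u + d], the chord from [m] ends at the origin and rises by at most [e] because of
   [lt2]; the chord from [0] rises by more than [e] because of [lt1]. This gives the sign change of
   [p]. *)
have [g _ gK] := cx_bij R.
have := gK (- d); rewrite /cx; move: (g (- d)) => m.
case: (ltP m 0) => [m0 mE|]; last by lra.
have [||u /andP[mu u0] /rootP] := @poly_ivt _ p m 0; first exact: ltW.
  by rewrite !pE mE addNr; apply/andP; split; nra.
rewrite pE => up.
have v0 : 0 <= u - u ^+ 2 + d by nra.
exists u, (u - u ^+ 2 + d); rewrite (ltNge _ 0) v0 /=.
by case: (ltP u 0) => u_lt0; split; nra.
Qed.

Theorem theorem4p6 (R : realType) :
  exists L : R -> R -> R, semi_vatican L /\ based_on_additive_group L.
Proof.
have [g cxK gK] := cx_bij R.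
pose a x : R := cy (g x).
have bij_a : bijective a by apply: bij_comp (cy_bij R) _; exists cx.
have tangent x : exists2 s, 0 < s & forall y, y != x -> s * (y - x) < a y - a x.
  have [s s0 H] := curve_above_tangent R (g x); exists s => // y yx.
  by rewrite -{1}(gK y) -{1}(gK x); apply: H; rewrite (can_eq gK).
have a_incr : {homo a : x y / x < y}.
  move=> x y xy; have [s s0 /(_ y)] := tangent x.
  by rewrite gt_eqF // => /(_ isT); nra.
have increment_incr d j k : 0 < d -> j < k -> a (j + d) - a j < a (k + d) - a k.
  move=> d0 jk.
  have [s s0 H] := tangent (j + d); have [t t0 K] := tangent k.
  have H1 := H j ltac:(apply/eqP; lra); have H2 := H (k + d) ltac:(apply/eqP; lra).
  have K1 := K j ltac:(apply/eqP; lra); have K2 := K (k + d) ltac:(apply/eqP; lra).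
  (* Both [a (j + d)] and [a k] lie below the chord over [[j, k + d]]. *)
  have HH : (d + (k - j)) * a (j + d) < (k - j) * a j + d * a (k + d) by nra.
  have KK : (d + (k - j)) * a k < d * a j + (k - j) * a (k + d) by nra.
  (* The sum of [HH] and [KK] is the claim multiplied by [d + (k - j)]. *)
  by nra.
exists (fun i j => a j - a i); split; last by exists a.
apply: semi_vatican_increments => // d e d0 e0.
have [u [v [uv1 uv2]]] := curve_chord R d e d0 e0.
have E : a (cx u + d) - a (cx u) = e.
  have -> : cx u + d = cx v by lra.
  by rewrite /a !cxK.
exists (cx u); split=> // k kE.
have [lt|gt|//] := ltgtP (cx u) k.
  by have := increment_incr d _ _ d0 lt; lra.
by have := increment_incr d _ _ d0 gt; lra.
Qed.
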